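(* Let $\phi_{\mathrm{xor}}$ be a conjunction of xor-constraints, $X\subseteq\mathrm{vars}(\phi_{\mathrm{xor}})$, and $(V_a,V_b)$ an $X$-cut partition of $\phi_{\mathrm{xor}}$. Let $\phi^{a}=\bigwedge_{D\in V_a}D$, $\phi^{b}=\bigwedge_{D\in V_b}D$, and let $l_1,\dots,l_k$ be literals over $\mathrm{vars}(\phi_{\mathrm{xor}})$. Then: (1) If $\phi_{\mathrm{xor}}\land l_1\land\dots\land l_k$ is unsatisfiable, then either $\phi^{a}\land l_1\land\dots\land l_k$ or $\phi^{b}\land l_1\land\dots\land l_k$ is unsatisfiable; or $\phi^{a}\land l_1\land\dots\land l_k\models(X'\equiv p')$ and $\phi^{b}\land l_1\land\dots\land l_k\models(X'\equiv p'\oplus\top)$ for some $X'\subseteq X$ and $p'\in\{\top,\bot\}$. (2) If $\phi_{\mathrm{xor}}\land l_1\land\dots\land l_k$ is satisfiable and $\phi_{\mathrm{xor}}\land l_1\land\dots\land l_k\models(Y\equiv p)$ for some $p\in\{\top,\bot\}$ and some $Y\subseteq\mathrm{vars}(\phi^{\alpha})$ with $Y\cap(\mathrm{vars}(\phi^{\beta})\setminus\mathrm{vars}(\phi^{\alpha}))=\emptyset$, where $\alpha\in\{a,b\}$ and $\beta$ is the other element of $\{a,b\}$, then either $\phi^{a}\land l_1\land\dots\land l_k\models(Y\equiv p)$ or $\phi^{b}\land l_1\land\dots\land l_k\models(Y\equiv p)$; or $\phi^{\alpha}\land l_1\land\dots\land l_k\models(X'\equiv p')$ and $\phi^{\beta}\land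 l_1\land\dots\land l_k\land(X'\equiv p')\models(Y\equiv p)$ for some $X'\subseteq X$, $p'\in\{\top,\bot\}$, $\alpha\in\{a,b\}$ and $\beta\in\{a,b\}\setminus\{\alpha\}$.
   Context: An xor-constraint is an equation $x_1\oplus\dots\oplus x_n\equiv p$ with Boolean variables and $p\in\{\bot,\top\}$; a literal $x$ (resp. $\neg x$) is identified with $x\equiv\top$ (resp. $x\equiv\bot$). For a set of variables $Z=\{z_1,\dots,z_n\}$, $(Z\equiv p)$ denotes $(z_1\oplus\dots\oplus z_n\equiv p)$. For a set $S$ of xor-constraints, $\mathrm{vars}(S)$ is the set of variables occurring in them. Given a conjunction $\phi_{\mathrm{xor}}$ of xor-constraints and $X\subseteq\mathrm{vars}(\phi_{\mathrm{xor}})$, an $X$-cut partition of $\phi_{\mathrm{xor}}$ is a partition $(V_a,V_b)$ of the set of xor-constraints of $\phi_{\mathrm{xor}}$ with $\mathrm{vars}(V_a)\cap\mathrm{vars}(V_b)=X$. *)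

(* Defs.v *)
From HB Require Import structures.
From mathcomp Require Import all_boot finmap.

Set Implicit Arguments.
Unset Strict Implicit.
Unset Printing Implicit Defensive.

Local Open Scope fset_scope.

Section XorConstraints.
Variable V : choiceType.

(* ([:: x_1; ...; x_n], p) is the equation x_1 (+) ... (+) x_n = p. The
   left-hand side may be empty (its value is then false) and may repeat a
   variable; a repeated variable still occurs in the constraint. *)
Definition xor_constraint : Type := (seq V * bool)%type.
HB.instance Definition _ := Choice.on xor_constraint.

(* (x, true) is the literal x, (x, false) is the literal ~x. *)
Definition literal : Type := (V * bool)%type.

Definition xor_of_literal (l : literal) : xor_constraint := ([:: l.1], l.2).

Definition xor_of_set (Z : {fset V}) (p : bool) : xor_constraint :=
  (enum_fset Z, p).

Definition conjunction : Type := seq xor_constraint.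

Definition conj_of_set (S : {fset xor_constraint}) : conjunction :=
  enum_fset S.

Definition vars (S : {fset xor_constraint}) : {fset V} :=
  [fset x in flatten [seq D.1 | D <- enum_fset S]].

Definition constraints (phi : conjunction) : {fset xor_constraint} :=
  [fset D in phi].

Definition and_literals (phi : conjunction) (ls : seq literal) : conjunction :=
  phi ++ map xor_of_literal ls.

Definition satisfies (tau : V -> bool) (D : xor_constraint) : bool :=
  \big[addb/false]_(x <- D.1) tau x == D.2.

Definition satisfiable (phi : conjunction) : Prop :=
  exists tau : V -> bool, all (satisfies tau) phi.

Definition entails (phi : conjunction) (D : xor_constraint) : Prop :=
  forall tau : V -> bool, all (satisfies tau) phi -> satisfies tau D.

(* The blocks are allowed to be empty. *)
Definition is_cut_partition (phi : conjunction) (X : {fset V})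
    (Va Vb : {fset xor_constraint}) : Prop :=
  [/\ Va `|` Vb = constraints phi, Va `&` Vb = fset0 &
      vars Va `&` vars Vb = X].

End XorConstraints.

Inductive side := side_a | side_b.

Definition on_side (T : Type) (ta tb : T) (s : side) : T :=
  match s with side_a => ta | side_b => tb end.

(* Main.v *)
(* If an xor system is unsatisfiable then some sum of its constraints is 0 = 1
   (Gaussian elimination). Grouping the summands of that sum by block, each
   literal going to a block in which its variable occurs, gives two constraints
   S_a = p_a and S_b = p_b, entailed by the respective blocks, whose left-hand
   sides cancel. Hence S_a and S_b have the same variables of odd multiplicity,
   these lie in X, and p_b = p_a + 1: this is (1). For (2), apply (1) after
   adding Y = p + 1 to the block that contains Y and take the contrapositive. *)
Require Import Defs.
From mathcomp Require Import all_boot finmap.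

Local Open Scope fset_scope.

Definition xor_sum {V : choiceType} (tau : V -> bool) (s : seq V) : bool :=
  \big[addb/false]_(x <- s) tau x.

Lemma satisfiesE {V : choiceType} (tau : V -> bool) (D : xor_constraint V) :
  satisfies tau D = (xor_sum tau D.1 == D.2).
Proof. by []. Qed.

Lemma xor_sum_cat {V : choiceType} (tau : V -> bool) (s t : seq V) :
  xor_sum tau (s ++ t) = xor_sum tau s (+) xor_sum tau t.
Proof. exact: big_cat. Qed.

Lemma xor_sum_addb {V : choiceType} (tau tau' : V -> bool) (s : seq V) :
  xor_sum (fun x => tau x (+) tau' x) s = xor_sum tau s (+) xor_sum tau' s.
Proof. exact: big_split. Qed.

Lemma xor_sum_pred1 {V : choiceType} (x : V) (s : seq V) :
  xor_sum (pred1 x) s = odd (count_mem x s).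
Proof.
rewrite /xor_sum; elim: s => [|y s IHs]; first by rewrite big_nil.
by rewrite big_cons IHs /= oddD oddb.
Qed.

(** Odd multiplicity is tested by evaluating the sum at the indicator of [x], so sequences with
    equal sums under every assignment have equal [odd_vars] at once. *)
Definition odd_vars {V : choiceType} (s : seq V) : {fset V} :=
  [fset x in s | xor_sum (pred1 x) s].

Lemma xor_sum_odd_vars {V : choiceType} (tau : V -> bool) (s : seq V) :
  xor_sum tau (odd_vars s) = xor_sum tau s.
Proof.
rewrite /xor_sum.
have odd_perm : perm_eq (odd_vars s)
    [seq x <- undup s | xor_sum (pred1 x) s].
  apply: uniq_perm; rewrite ?fset_uniq ?filter_uniq ?undup_uniq // => x.
  by rewrite mem_filter mem_undup !inE /= andbC.
(* After grouping equal variables, each contributes its value iterated as often as it occurs, and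
   under xor only the parity of that number matters. *)
rewrite (perm_big _ odd_perm) big_filter -[RHS]big_undup_iterop_count big_mkcond.
apply: eq_bigr => x _; rewrite xor_sum_pred1 Monoid.iteropE.
by elim: (count_mem x s) => //= n <-; case: (odd n); case: (tau x).
Qed.

Lemma odd_varsP {V : choiceType} (s : seq V) (x : V) :
  (x \in odd_vars s) = xor_sum (pred1 x) s.
Proof.
rewrite !inE /= xor_sum_pred1; case: (boolP (x \in s)) => //= /count_memPn.
by move=> ->.
Qed.

Definition xor_add {V : choiceType} (D E : xor_constraint V) :
  xor_constraint V := (D.1 ++ E.1, D.2 (+) E.2).

Lemma entails_mem {V : choiceType} (phi : conjunction V) (D : xor_constraint V) :
  D \in phi -> entails phi D.
Proof. by move=> phiD tau /allP; apply. Qed.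

Lemma entails_xor_add {V : choiceType} (phi : conjunction V)
    (D E : xor_constraint V) :
  entails phi D -> entails phi E -> entails phi (xor_add D E).
Proof.
move=> hD hE tau htau; move: (hD _ htau) (hE _ htau).
by rewrite !satisfiesE xor_sum_cat => /eqP -> /eqP ->.
Qed.

(** Gaussian elimination, one constraint at a time. Taking any [P] closed under addition avoids
    recording which constraints are summed. *)
Lemma unsat_sum {V : choiceType} (P : xor_constraint V -> Prop)
    (phi : conjunction V) :
    (forall D E, P D -> P E -> P (xor_add D E)) ->
    (forall D, D \in phi -> P D) -> ~ satisfiable phi ->
  exists s : seq V, P (s, true) /\ forall tau, xor_sum tau s = false.
Proof.
move=> Padd; have [n] := ubnP (size phi).
elim: n phi => // n IHn [|D phi] /= szphi Pphi unsat.
  by case: unsat; exists xpredT.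
have PD : P D by apply: Pphi; rewrite mem_head.
have Ptl E : E \in phi -> P E by move=> phiE; apply: Pphi; rewrite inE phiE orbT.
(* If the left-hand side of [D] cancels, [D] is either the desired 0 = 1 or a vacuous 0 = 0, which
   is dropped. Otherwise [x] is the pivot. *)
have [D0|[x Dx]] := fset_0Vmem (odd_vars D.1).
  have Dz tau : xor_sum tau D.1 = false.
    by rewrite -xor_sum_odd_vars D0 /xor_sum big_nil.
  case Drhs: D.2; first by exists D.1; rewrite -Drhs -surjective_pairing.
  apply: (IHn phi) => // -[tau sat]; apply: unsat; exists tau.
  by rewrite /= sat satisfiesE Dz Drhs.
rewrite odd_varsP in Dx.
pose elim_x E := if xor_sum (pred1 x) E.1 then xor_add E D else E.
apply: (IHn (map elim_x phi)); first by rewrite size_map.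
  by move=> _ /mapP[E /Ptl PE ->]; rewrite /elim_x; case: ifP; auto.
(* No constraint of the reduced system depends on x, whose value is thus free
   to be adjusted so as to satisfy D. *)
case=> tau; rewrite all_map => /allP sat; apply: unsat.
pose c := xor_sum tau D.1 (+) D.2.
pose tau' y := tau y (+) (c && pred1 x y).
have tau'E s : xor_sum tau' s = xor_sum tau s (+) (c && xor_sum (pred1 x) s).
  rewrite xor_sum_addb; case: (c) => //=; congr (_ (+) _).
  by rewrite /xor_sum big1.
exists tau'; rewrite /= satisfiesE tau'E Dx; apply/andP; split.
  by rewrite /c; case: (xor_sum tau D.1); case: D.2.
(* If [x] has odd multiplicity in [E], then [tau] satisfies the sum of [E] and [D], so it violates
   both or neither, and flipping [x] repairs both. *)
apply/allP => E /sat; rewrite /= /elim_x !satisfiesE tau'E.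
case: (xor_sum (pred1 x) E.1); last by rewrite andbF addbF.
by rewrite /= xor_sum_cat /c;
  case: (xor_sum tau E.1); case: (xor_sum tau D.1); case: E.2; case: D.2.
Qed.

(** [A] and [B] are kept arbitrary so that, for (2), the negated goal can join one of the blocks. *)
Lemma xor_interpolation {V : choiceType} (phi A B : conjunction V)
    (U W : {fset V}) :
    ~ satisfiable phi ->
    (forall D, D \in phi -> entails A D /\ {subset D.1 <= U} \/
                            entails B D /\ {subset D.1 <= W}) ->
  exists (X : {fset V}) (p : bool),
    [/\ X `<=` U `&` W, entails A (xor_of_set X p) &
        entails B (xor_of_set X (p (+) true))].
Proof.
move=> unsat split_phi.
pose good A U (D : xor_constraint V) :=
  entails A D /\ {subset D.1 <= (U : {fset V})}.
have goodD C Z D E : good C Z D -> good C Z E -> good C Z (xor_add D E).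
  move=> [hD sD] [hE sE]; split; first exact: entails_xor_add.
  by move=> x; rewrite mem_cat => /orP[/sD|/sE].
have good0 C Z : good C Z ([::], false).
  by split=> // tau _; rewrite satisfiesE /xor_sum big_nil.
(* Left-hand sides are compared by value, not as sequences, because concatenation interleaves the
   two groups of summands. *)
pose P D := exists Da Db, [/\ good A U Da, good B W Db, D.2 = Da.2 (+) Db.2 &
  forall tau, xor_sum tau D.1 = xor_sum tau Da.1 (+) xor_sum tau Db.1].
have [||s [[Da [Db [[hA sA] [hB sB] /= rhs lhs]]] s0]] := unsat_sum P phi _ _ unsat.
- move=> D E [Da [Db [gDa gDb rD lD]]] [Ea [Eb [gEa gEb rE lE]]].
  exists (xor_add Da Ea), (xor_add Db Eb); split; [exact: goodD| exact: goodD | |].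
    by rewrite /= rD rE addbACA.
  by move=> tau; rewrite !xor_sum_cat lD lE addbACA.
- move=> D /split_phi[gD|gD].
    exists D, ([::], false); split=> // [|tau]; first by rewrite addbF.
    by rewrite [xor_sum tau [::]]big_nil addbF.
  by exists ([::], false), D; split=> // tau; rewrite [xor_sum tau [::]]big_nil.
have eqab tau : xor_sum tau Da.1 = xor_sum tau Db.1.
  by have := lhs tau; rewrite s0; case: (xor_sum _ _); case: (xor_sum _ _).
exists (odd_vars Da.1), Da.2; split.
- apply/fsubsetP => x xD; rewrite inE; apply/andP; split.
    by apply: sA; move: xD; rewrite !inE => /andP[].
  (* [eqab] at the indicator of [x] carries odd multiplicity from [Da] to [Db]. *)
  have: x \in odd_vars Db.1 by rewrite odd_varsP -eqab -odd_varsP.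
  by rewrite !inE => /andP[/sB].
- by move=> tau /hA; rewrite !satisfiesE xor_sum_odd_vars.
- move=> tau /hB; rewrite !satisfiesE xor_sum_odd_vars eqab => /eqP ->.
  by move: rhs; case: Da.2; case: Db.2.
Qed.

Lemma varsU {V : choiceType} (S T : {fset xor_constraint V}) :
  vars (S `|` T) = vars S `|` vars T.
Proof.
apply/fsetP => x; rewrite !inE; apply/flatten_mapP/orP => [[D]|].
  by rewrite inE => /orP[SD xD|TD xD]; [left|right]; apply/flatten_mapP; exists D.
by case=> /flatten_mapP[D SD xD]; exists D; rewrite // inE SD ?orbT.
Qed.

(** A literal belongs to both conjunctions, so it may be assigned to whichever block contains its
    variable. *)
Lemma cut_split {V : choiceType} (phi : conjunction V)
    (S T : {fset xor_constraint V}) (ls : seq (literal V)) :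
    S `|` T = constraints phi ->
    (forall l : literal V, l \in ls -> l.1 \in vars (constraints phi)) ->
  forall D, D \in and_literals phi ls ->
    D \in and_literals (conj_of_set S) ls /\ {subset D.1 <= vars S} \/
    D \in and_literals (conj_of_set T) ls /\ {subset D.1 <= vars T}.
Proof.
move=> ST hls D; rewrite !mem_cat.
have in_block (R : {fset xor_constraint V}) : D \in R ->
    D \in conj_of_set R /\ {subset D.1 <= vars R}.
  by move=> RD; split=> // x xD; rewrite !inE; apply/flatten_mapP; exists D.
case/orP=> [phiD|lsD].
  have: D \in S `|` T by rewrite ST !inE.
  by rewrite inE => /orP[/in_block[-> sD]|/in_block[-> sD]]; [left|right].
have [l ll ->] := mapP lsD; rewrite map_f // !orbT.
have := hls l ll; rewrite -ST varsU inE => /orP[hl|hl]; [left|right];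
  by split=> // x; rewrite inE => /eqP ->.
Qed.

Theorem theorem6 (V : choiceType) (phi : conjunction V) (X : {fset V})
    (hX : X `<=` vars (constraints phi))
    (Va Vb : {fset xor_constraint V})
    (hcut : is_cut_partition phi X Va Vb)
    (ls : seq (literal V))
    (hls : forall l : literal V, l \in ls -> l.1 \in vars (constraints phi)) :
  let block : side -> {fset xor_constraint V} := on_side Va Vb in
  let phi_ (s : side) : conjunction V := conj_of_set (block s) in
  (~ satisfiable (and_literals phi ls) ->
     (~ satisfiable (and_literals (phi_ side_a) ls) \/
      ~ satisfiable (and_literals (phi_ side_b) ls)) \/
     exists (X' : {fset V}) (p' : bool),
       [/\ X' `<=` X,
           entails (and_literals (phi_ side_a) ls) (xor_of_set X' p') &
           entails (and_literals (phi_ side_b) ls)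
                   (xor_of_set X' (p' (+) true))])
  /\
  (forall (alpha beta : side) (Y : {fset V}) (p : bool),
     beta <> alpha ->
     satisfiable (and_literals phi ls) ->
     entails (and_literals phi ls) (xor_of_set Y p) ->
     Y `<=` vars (block alpha) ->
     Y `&` (vars (block beta) `\` vars (block alpha)) = fset0 ->
     (entails (and_literals (phi_ side_a) ls) (xor_of_set Y p) \/
      entails (and_literals (phi_ side_b) ls) (xor_of_set Y p)) \/
     exists (X' : {fset V}) (p' : bool) (alpha' beta' : side),
       [/\ beta' <> alpha',
           X' `<=` X,
           entails (and_literals (phi_ alpha') ls) (xor_of_set X' p') &
           entails (rcons (and_literals (phi_ beta') ls) (xor_of_set X' p'))
                   (xor_of_set Y p)]).
Proof.
case: hcut => hU _ hX0 block phi_; split=> [unsat|].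
  right; have [|X' [p' [sX hA hB]]] := xor_interpolation _
    (and_literals (phi_ side_a) ls) (and_literals (phi_ side_b) ls)
    (vars Va) (vars Vb) unsat.
    by move=> D /(cut_split _ _ _ _ hU hls)[[/entails_mem ? ?]|[/entails_mem ? ?]];
      [left|right].
  by exists X', p'; rewrite -hX0.
move=> alpha beta Y p neq _ entY sY _; right.
have [hU' hX'] : block alpha `|` block beta = constraints phi /\
    vars (block alpha) `&` vars (block beta) = X.
  by case: alpha beta neq {sY} => [] [] //= _; rewrite 1?fsetUC 1?fsetIC.
(* The negation of the goal is again an xor-constraint, and its variables lie in block [alpha]. *)
have [||X' [p' [sX hA hB]]] := xor_interpolation
  (rcons (and_literals phi ls) (xor_of_set Y (~~ p)))
  (rcons (and_literals (phi_ alpha) ls) (xor_of_set Y (~~ p)))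
  (and_literals (phi_ beta) ls) (vars (block alpha)) (vars (block beta)).
- case=> tau; rewrite all_rcons => /andP[+ /entY].
  by rewrite !satisfiesE => /eqP -> /=; case: (p).
- move=> D; rewrite mem_rcons inE => /predU1P[->|].
    left; split; last by move=> x /(fsubsetP sY).
    by apply: entails_mem; rewrite mem_rcons mem_head.
  move=> /(cut_split _ _ _ _ hU' hls)[[hD ?]|[/entails_mem ? ?]]; [left|by right].
  by split=> //; apply: entails_mem; rewrite mem_rcons inE hD orbT.
(* The sides swap: [beta] supplies the constraint on [X']. It contradicts what [alpha] derives from
   the negated goal, so [alpha] with this constraint entails the goal. *)
exists X', (p' (+) true), beta, alpha; rewrite -hX'; split=> //.
  by move/esym.
move=> tau; rewrite all_rcons => /andP[satX sat].
have := hA tau; rewrite all_rcons sat andbT; move: satX.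
rewrite !satisfiesE /= => /eqP ->.
by case: (xor_sum tau Y); case: (p); case: (p') => // /(_ isT).
Qed.
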